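(* Let $(a_n)_{n \ge 1}$ be a sequence of positive real numbers and, for $n \ge 2$, let $$u_n = \frac{\sqrt[n-1]{a_{n-1}}\,\sqrt[n+1]{a_{n+1}}}{\left(\sqrt[n]{a_n}\right)^{2}}.$$ Let $N \ge 2$ be an integer and let $\widetilde{f_n}$, $\widetilde{g_n}$ be rational functions of $n$ with $0 < \widetilde{f_n} < u_n < \widetilde{g_n}$ for all $n \ge N$. Put $$\widetilde{p_{n}} = \frac{n}{n+1} \frac{\widetilde{f_{n+1}}}{\widetilde{g_{n}}},\qquad \widetilde{q_{n}} = \frac{n}{n+1} \frac{\widetilde{g_{n+1}}}{\widetilde{f_{n}}}.$$ If for all $n \ge N$, $$t(\widetilde{p_{n}},\widetilde{p_{n+1}}) > 0,\ t(\widetilde{p_{n}},\widetilde{q_{n+1}}) > 0,\ t(\widetilde{q_{n}},\widetilde{p_{n+1}}) > 0,\ t(\widetilde{q_{n}},\widetilde{q_{n+1}}) > 0,$$ where $t(x,y)=4(1-x)(1-y)-(1-xy)^2$, then the sequence $(c_n)_{n\ge N}$ with $c_n = \sqrt[n+1]{a_{n+1}}/(\sqrt[n]{a_n}\, n!)$ satisfies the higher order Turán inequality.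
   Context: A sequence $(c_n)_{n \ge m}$ of real numbers satisfies the higher order Turán inequality if for all $n \ge m+1$, $$4(c_{n}^2 - c_{n-1}c_{n+1})(c_{n+1}^2 - c_{n}c_{n+2}) - (c_{n}c_{n+1} - c_{n-1}c_{n+2})^2 \ge 0.$$ *)

(* Defs.v *)
From mathcomp Require Import all_boot all_order all_algebra.
From mathcomp Require Import reals exp.

Set Implicit Arguments.
Unset Strict Implicit.
Unset Printing Implicit Defensive.

Import Order.TTheory GRing.Theory Num.Theory.
Local Open Scope ring_scope.

Definition higher_order_turan (R : realType) (m : nat) (c : nat -> R) : Prop :=
  forall n : nat, (m + 1 <= n)%N ->
    0 <= 4 * (c n ^+ 2 - c (n - 1)%N * c (n + 1)%N)
           * (c (n + 1)%N ^+ 2 - c n * c (n + 2)%N)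
         - (c n * c (n + 1)%N - c (n - 1)%N * c (n + 2)%N) ^+ 2.

(* The real k-th root of x; meaningful only for 0 < k and 0 <= x. *)
Definition nth_root (R : realType) (k : nat) (x : R) : R := x `^ (k%:R^-1).

(* f agrees on the integers n >= N with a rational function over R that has
   no pole there. Only the values f n with n >= N matter. Asking that the
   denominator not vanish loses no generality: take the fraction in lowest
   terms. *)
Definition rational_from (R : realType) (N : nat) (f : nat -> R) : Prop :=
  exists P Q : {poly R}, forall n : nat, (N <= n)%N ->
    Q.[n%:R] != 0 /\ f n = P.[n%:R] / Q.[n%:R].

(* Used for 2 <= n. *)
Definition u_seq (R : realType) (a : nat -> R) (n : nat) : R :=
  nth_root (n - 1) (a (n - 1)%N) * nth_root (n + 1) (a (n + 1)%N)
    / nth_root n (a n) ^+ 2.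

Definition p_seq (R : realType) (f g : nat -> R) (n : nat) : R :=
  n%:R / (n + 1)%:R * (f (n + 1)%N / g n).

Definition q_seq (R : realType) (f g : nat -> R) (n : nat) : R :=
  n%:R / (n + 1)%:R * (g (n + 1)%N / f n).

Definition t_fun (R : realType) (x y : R) : R :=
  4 * (1 - x) * (1 - y) - (1 - x * y) ^+ 2.

Definition c_seq (R : realType) (a : nat -> R) (n : nat) : R :=
  nth_root (n + 1) (a (n + 1)%N) / (nth_root n (a n) * n`!%:R).

(* Main.v *)
(** Put [w n = c (n-1) c (n+1) / c n ^ 2].  The higher order Turán expression at
    [n] equals [(c n c (n+1))^2 t(w n, w (n+1))], and
    [w n = n / (n+1) * (u (n+1) / u n)] lies between [p n] and [q n].  As [t] is
    concave in each variable separately, its positivity at the four corners of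
    [[p n, q n] x [p (n+1), q (n+1)]] gives positivity on the whole rectangle. *)

Require Import Defs.
From mathcomp Require Import all_boot all_order all_algebra.
From mathcomp Require Import reals exp.
From mathcomp Require Import ring.

Set Implicit Arguments.
Unset Strict Implicit.
Unset Printing Implicit Defensive.

Import Order.TTheory GRing.Theory Num.Theory.
Local Open Scope ring_scope.

Lemma t_funC (R : realType) (x y : R) : t_fun x y = t_fun y x.
Proof. by rewrite /t_fun; ring. Qed.

(** In [x], [t_fun x y] is quadratic with leading coefficient [- y ^+ 2], hence concave, and so lies
    above its chord over [[p, q]]. *)
Lemma t_fun_gt0_segment (R : realType) (p q x y : R) :
  p < x -> x < q -> 0 < t_fun p y -> 0 < t_fun q y -> 0 < t_fun x y.
Proof.
move=> px xq tp tq.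
have pq : 0 < q - p by rewrite subr_gt0 (lt_trans px).
rewrite -(pmulr_rgt0 _ pq).
(* Chord interpolation with its exact error term, cleared of the denominator [q - p]. *)
have -> : (q - p) * t_fun x y = (q - x) * t_fun p y + (x - p) * t_fun q y
    + y ^+ 2 * ((q - p) * (x - p) * (q - x)).
  by rewrite /t_fun; ring.
have xp : 0 < x - p by rewrite subr_gt0.
have qx : 0 < q - x by rewrite subr_gt0.
apply: ltr_wpDr; last by rewrite addr_gt0 // mulr_gt0.
by rewrite mulr_ge0 ?sqr_ge0 // ltW // !mulr_gt0.
Qed.

Lemma t_fun_gt0_rectangle (R : realType) (p q p' q' x y : R) :
  p < x -> x < q -> p' < y -> y < q' ->
  0 < t_fun p p' -> 0 < t_fun p q' -> 0 < t_fun q p' -> 0 < t_fun q q' ->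
  0 < t_fun x y.
Proof.
move=> px xq py yq tpp tpq tqp tqq.
(* Move in [x] first; at each end [p], [q], symmetry lets the same lemma move along [[p', q']]. *)
apply: (t_fun_gt0_segment px xq); rewrite t_funC;
  by apply: (t_fun_gt0_segment py yq); rewrite t_funC.
Qed.

(** The two arguments of [t_fun] multiply to [b * e / (c * d)], so [(c * d) ^+ 2] factors out of
    both terms. *)
Lemma turan_t_fun (R : realType) (b c d e : R) : c != 0 -> d != 0 ->
  4 * (c ^+ 2 - b * d) * (d ^+ 2 - c * e) - (c * d - b * e) ^+ 2
  = (c * d) ^+ 2 * t_fun (b * d / c ^+ 2) (c * e / d ^+ 2).
Proof. by move=> c0 d0; rewrite /t_fun; field; rewrite c0 d0. Qed.

Lemma ratio_bounds (R : realType) (f0 g0 u0 f1 g1 u1 k : R) :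
  0 < k -> 0 < f0 -> f0 < u0 -> u0 < g0 -> 0 < f1 -> f1 < u1 -> u1 < g1 ->
  k * (f1 / g0) < k * (u1 / u0) /\ k * (u1 / u0) < k * (g1 / f0).
Proof.
move=> k0 f0_gt0 fu0 ug0 f1_gt0 fu1 ug1.
have u0_gt0 := lt_trans f0_gt0 fu0; have g0_gt0 := lt_trans u0_gt0 ug0.
have u1_gt0 := lt_trans f1_gt0 fu1.
by rewrite !ltr_pM2l //; split; apply: ltr_pM;
  rewrite ?invr_ge0 ?ltf_pV2 ?posrE // ltW.
Qed.

Section PositiveSequence.
Variables (R : realType) (a : nat -> R).
Hypothesis a_gt0 : forall n : nat, (1 <= n)%N -> 0 < a n.

Lemma c_seq_gt0 (n : nat) : (1 <= n)%N -> 0 < c_seq a n.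
Proof.
move=> n_gt0; rewrite /c_seq /nth_root divr_gt0 ?mulr_gt0 ?powR_gt0 ?a_gt0 //.
  by rewrite addn1.
by rewrite ltr0n fact_gt0.
Qed.

(** The factorials leave [n / (n + 1)]; the roots regroup into the quotient of consecutive
    [u_seq]. *)
Lemma c_seq_ratio (n : nat) : (2 <= n)%N ->
  c_seq a (n - 1) * c_seq a (n + 1) / c_seq a n ^+ 2
  = n%:R / (n + 1)%:R * (u_seq a (n + 1) / u_seq a n).
Proof.
(* Writing [n] as [m.+2] removes the truncated subtractions. *)
case: n => [|[|m]] // _; rewrite /c_seq /u_seq !addn1 !subn1 /=.
have root_neq0 k : nth_root k.+1 (a k.+1) != 0.
  by rewrite gt_eqF // powR_gt0 // a_gt0.
have fact_neq0 : (m`!)%:R != 0 :> R by rewrite pnatr_eq0 -lt0n fact_gt0.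
have m1 : 1 + m%:R != 0 :> R by rewrite nat1r pnatr_eq0.
have m2 : 2 + m%:R != 0 :> R by rewrite -natrD pnatr_eq0.
have m3 : 3 + m%:R != 0 :> R by rewrite -natrD pnatr_eq0.
move: (root_neq0 m) (root_neq0 m.+1) (root_neq0 m.+2) (root_neq0 m.+3).
rewrite !factS !natrM.
move: (nth_root _ _) (nth_root _ _) (nth_root _ _) (nth_root _ _).
move=> r1 r2 r3 r4 h1 h2 h3 h4.
by field; rewrite ?h1 ?h2 ?h3 ?h4 ?fact_neq0 ?m1 ?m2 ?m3.
Qed.

End PositiveSequence.

Theorem theorem2p4 (R : realType) (a : nat -> R)
    (a_gt0 : forall n : nat, (1 <= n)%N -> 0 < a n)
    (N : nat) (N_ge2 : (2 <= N)%N)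
    (f g : nat -> R)
    (f_rat : rational_from N f) (g_rat : rational_from N g)
    (u_bounds : forall n : nat, (N <= n)%N ->
       [/\ 0 < f n, f n < u_seq a n & u_seq a n < g n])
    (t_pos : forall n : nat, (N <= n)%N ->
       [/\ 0 < t_fun (p_seq f g n) (p_seq f g (n + 1)),
           0 < t_fun (p_seq f g n) (q_seq f g (n + 1)),
           0 < t_fun (q_seq f g n) (p_seq f g (n + 1)) &
           0 < t_fun (q_seq f g n) (q_seq f g (n + 1))]) :
  higher_order_turan N (c_seq a).
Proof.
have ratio_in n : (N <= n)%N ->
    p_seq f g n < c_seq a (n - 1) * c_seq a (n + 1) / c_seq a n ^+ 2 /\
    c_seq a (n - 1) * c_seq a (n + 1) / c_seq a n ^+ 2 < q_seq f g n.
  move=> Nn; have n_ge2 := leq_trans N_ge2 Nn.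
  have [f0 fu0 ug0] := u_bounds _ Nn.
  have [f1 fu1 ug1] := u_bounds _ (leq_trans Nn (leq_addr 1 n)).
  rewrite c_seq_ratio //; apply: ratio_bounds => //.
  by rewrite divr_gt0 // ltr0n ?addn1 // (leq_trans _ n_ge2).
move=> n Nn1; have Nn : (N <= n)%N by rewrite (leq_trans _ Nn1) ?leq_addr.
have n_gt0 : (1 <= n)%N by rewrite (leq_trans _ Nn) // ltnW.
have [px xq] := ratio_in n Nn.
have := ratio_in (n + 1)%N (leq_trans Nn (leq_addr 1 n)).
(* The ratio at [n + 1] now involves [c_seq] at [n], [n + 1] and [n + 2], as in the second argument
   of [t_fun]. *)
rewrite addnK -addnA => -[py yq].
have [tpp tpq tqp tqq] := t_pos _ Nn.
rewrite turan_t_fun; last 2 first.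
- by rewrite gt_eqF // c_seq_gt0.
- by rewrite gt_eqF // c_seq_gt0 // addn1.
rewrite mulr_ge0 ?sqr_ge0 // ltW //.
exact: (t_fun_gt0_rectangle px xq py yq).
Qed.
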